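(* Let $K/k$ be a separable field extension of degree $6$ and let $\widetilde{K}/k$ be its Galois closure. Assume that $\operatorname{Gal}(\widetilde{K}/k)=S_6$ and let $F$ be a field with $K\subset F\subset\widetilde{K}$. (a) If $[F:k]=360$ and $\operatorname{Gal}(\widetilde{K}/F)$ is generated by a transposition, then $F/k$ is almost classically Galois. (b) If $[F:k]<360$, then $F/k$ is not Hopf Galois.
   Context: The Galois group $G=\operatorname{Gal}(\widetilde{K}/k)$ is identified with $S_6$ via its left translation action on the six left cosets $G/\operatorname{Gal}(\widetilde{K}/K)$. A finite extension of fields $L/k$ is called Hopf Galois if there exists a finite cocommutative $k$-Hopf algebra $H$ such that $L$ is an $H$-module algebra and the $k$-linear map $j: L\otimes_k H\to \operatorname{End}_k(L)$, $j(s\otimes h)(t)=s(ht)$ for $h\in H$, $s,t\in L$, is bijective. Let $L/k$ be a finite separable extension with Galois closure $\widetilde{L}/k$, $\Gamma=\operatorname{Gal}(\widetilde{L}/k)$, $\Gamma'=\operatorname{Gal}(\widetilde{L}/L)$, and let $\lambda:\Gamma\to\operatorname{Sym}(\Gamma/\Gamma')$ be the left translation action on left cosets. $L/k$ is called almost classically Galois if there is a regular (i.e. sharply transitive) subgroup $N$ of $\operatorname{Sym}(\Gamma/\Gamma')$ which is normalized by $\lambda(\Gamma)$ and contained in $\lambda(\Gamma)$; equivalently, $\Gamma'$ has a normal complement in $\Gamma$. *)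

(* Defs.v *)
From HB Require Import structures.
From mathcomp Require Import all_boot all_order all_algebra.
From mathcomp Require Import all_fingroup all_solvable all_field.

Set Implicit Arguments.
Unset Strict Implicit.
Unset Printing Implicit Defensive.

Import GRing.Theory.
Local Open Scope ring_scope.

(* V (x) W is realized on coordinates: tens v w is the rank-one matrix of the  *)
(* products of the coordinates of v and w in the bases vbasis fullv.  The      *)
(* lemmas tlift_linear, tlift_tens and tensor_ext give the universal property. *)
(* tlift b t is the Sweedler sum of the b t_(1) t_(2).                         *)
Definition tensor (k : fieldType) (V W : vectType k) : Type :=
  'M[k]_(\dim {:V}, \dim {:W}).

HB.instance Definition _ (k : fieldType) (V W : vectType k) :=
  Vector.on (tensor V W).

Section Tensor.
Variable k : fieldType.
Variables V W : vectType k.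

Definition tens (v : V) (w : W) : tensor V W :=
  \matrix_(i, j) (coord (vbasis fullv) i v * coord (vbasis fullv) j w).

Definition tlift (U : lmodType k) (b : V -> W -> U) (t : tensor V W) : U :=
  \sum_i \sum_j t i j *: b (vbasis fullv)`_i (vbasis fullv)`_j.

Lemma tens_linearl w : linear (tens^~ w).
Proof.
by move=> a x y; apply/matrixP=> i j; rewrite !mxE linearP /= mulrDl mulrA.
Qed.

Lemma tens_linearr v : linear (tens v).
Proof.
by move=> a x y; apply/matrixP=> i j; rewrite !mxE linearP /= mulrDr mulrCA.
Qed.

Lemma tlift_linear (U : lmodType k) (b : V -> W -> U) : linear (tlift b).
Proof.
move=> a s t; rewrite /tlift scaler_sumr -big_split /=; apply: eq_bigr => i _.
rewrite scaler_sumr -big_split /=; apply: eq_bigr => j _.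
by rewrite !mxE scalerDl scalerA.
Qed.

Lemma tlift_tens (U : lmodType k) (b : V -> W -> U) v w :
  (forall y, linear (b^~ y)) -> (forall x, linear (b x)) ->
  tlift b (tens v w) = b v w.
Proof.
move=> bl br.
have sum_lin (X : vectType k) (f : X -> U) : linear f ->
    forall n (c : 'I_n -> k) (x : 'I_n -> X),
    f (\sum_i c i *: x i) = \sum_i c i *: f (x i).
  move=> lf n c x.
  have f0 : f 0 = 0.
    by have := lf (-1) 0 0; rewrite !scaleN1r oppr0 addr0 addNr.
  apply: (big_ind2 (fun u z => f u = z)) => //.
    by move=> u1 z1 u2 z2 <- <-; have := lf 1 u1 u2; rewrite !scale1r.
  by move=> i _; have := lf (c i) (x i) 0; rewrite f0 !addr0.
rewrite [in RHS](coord_vbasis (memvf v)) [in RHS](coord_vbasis (memvf w)).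
rewrite (sum_lin _ (b^~ _) (bl _)) /tlift; apply: eq_bigr => i _.
rewrite (sum_lin _ _ (br _)) scaler_sumr; apply: eq_bigr => j _.
by rewrite !mxE scalerA.
Qed.

Lemma tens_basis (t : tensor V W) :
  t = \sum_i \sum_j t i j *: tens (vbasis fullv)`_i (vbasis fullv)`_j.
Proof.
have fV := basis_free (vbasisP {:V}); have fW := basis_free (vbasisP {:W}).
apply/matrixP=> p q; rewrite summxE (bigD1 p) //= summxE (bigD1 q) //=.
rewrite !mxE !coord_free // !eqxx !mulr1 !big1 ?addr0 //.
  move=> i /negPf nip; rewrite summxE big1 // => j _.
  by rewrite !mxE !coord_free // nip mul0r mulr0.
by move=> j /negPf njq; rewrite !mxE !coord_free // njq !mulr0.
Qed.

Lemma tensor_ext (U : lmodType k) (f g : {linear tensor V W -> U}) :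
  (forall v w, f (tens v w) = g (tens v w)) -> f =1 g.
Proof.
move=> efg t; rewrite [t]tens_basis !linear_sum; apply: eq_bigr => i _.
rewrite !linear_sum; apply: eq_bigr => j _.
by rewrite !linearZ /= efg.
Qed.

End Tensor.

Section HopfGalois.
Variable k : fieldType.

Definition tmul (A : falgType k) (s t : tensor A A) : tensor A A :=
  tlift (fun a b => tlift (fun c d => tens (a * c) (b * d)) t) s.

(* In comulA both sides are compared in (H (x) H) (x) H, the right-hand side   *)
(* after the associator H (x) (H (x) H) -> (H (x) H) (x) H.                    *)
Record hopfAlgebra := HopfAlgebra {
  hopf_alg :> falgType k;
  comul : 'Hom(hopf_alg, tensor hopf_alg hopf_alg);
  counit : 'Hom(hopf_alg, k^o);
  antipode : 'Hom(hopf_alg, hopf_alg);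
  comul1 : comul 1 = tens 1 1;
  comulM : forall x y, comul (x * y) = tmul (comul x) (comul y);
  counit1 : counit 1 = 1;
  counitM : forall x y, counit (x * y) = counit x * counit y;
  comulA : forall h,
    tlift (fun a b => tens (comul a) b) (comul h) =
    tlift (fun a b => tlift (fun c d => tens (tens a c) d) (comul b)) (comul h);
  counit_comull : forall h, tlift (fun a b => counit a *: b) (comul h) = h;
  counit_comulr : forall h, tlift (fun a b => counit b *: a) (comul h) = h;
  antipodel : forall h,
    tlift (fun a b => antipode a * b) (comul h) = (counit h)%:A;
  antipoder : forall h,
    tlift (fun a b => a * antipode b) (comul h) = (counit h)%:A
}.

Definition cocommutative (H : hopfAlgebra) : Prop :=
  forall h : H, tlift (fun a b => tens b a) (comul H h) = comul H h.

Definition module_algebra (H : hopfAlgebra) (L : fieldExtType k)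
    (act : 'Hom(H, 'End(L))) : Prop :=
  [/\ forall s : L, act 1 s = s,
      forall (x y : H) (s : L), act (x * y) s = act x (act y s),
      forall h : H, act h 1 = (counit H h)%:A
    & forall (h : H) (s t : L),
        act h (s * t) = tlift (fun a b => act a s * act b t) (comul H h)].

Definition hopf_galois_map (H : hopfAlgebra) (L : fieldExtType k)
    (act : 'Hom(H, 'End(L))) : tensor L H -> 'End(L) :=
  tlift (fun (s : L) (h : H) => (amull s \o act h)%VF).

Lemma hopf_galois_mapE (H : hopfAlgebra) (L : fieldExtType k)
    (act : 'Hom(H, 'End(L))) (s t : L) (h : H) :
  hopf_galois_map act (tens s h) t = s * act h t.
Proof.
rewrite /hopf_galois_map tlift_tens => [|y a u v|x a u v].
- by rewrite comp_lfunE lfunE.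
- by apply/lfunP=> z; rewrite linearP comp_lfunDl comp_lfunZl.
- by rewrite linearP comp_lfunDr comp_lfunZr.
Qed.

Definition Hopf_Galois (L : fieldExtType k) : Prop :=
  exists (H : hopfAlgebra) (act : 'Hom(H, 'End(L))),
    [/\ cocommutative H, module_algebra act & bijective (hopf_galois_map act)].

End HopfGalois.

Local Open Scope group_scope.

Definition sharply_transitive (T : finType) (S : {set T})
    (N : {set {perm T}}) : Prop :=
  {in S &, forall x y, exists! s : {perm T}, s \in N /\ s x = y}.

Section Translation.
Variable gT : finGroupType.
Variables G H : {group gT}.

(* The product of 'Gal(E / F) is (x * y) a = y (x a), opposite to composition  *)
(* of functions (galM), and likewise for permutations (permM).  Hence the left *)
(* coset {g \o h | h in H} of the usual convention is the right coset H :* g   *)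
(* here, and left translation by g is X |-> X :* g.                            *)
Definition cosets : {set {set gT}} := rcosets H G.

Definition translation (g : gT) : {perm {set gT}} :=
  restr_perm cosets (actperm 'Rs g).

Lemma translation_on g : perm_on cosets (translation g).
Proof. exact: restr_perm_on. Qed.

Lemma translationE g X :
  g \in G -> X \in cosets -> translation g X = X :* g.
Proof.
move=> Gg SX; rewrite /translation restr_permE ?actpermE /=; first exact: rcosetE.
  2: exact: SX.
rewrite !inE; apply/subsetP=> _ /rcosetsP[x Gx ->].
rewrite inE /= apermE actpermE /= rcosetE -rcosetM.
by apply/rcosetsP; exists (x * g); rewrite ?groupM.
Qed.

Definition translation_transposition (t : gT) : Prop :=
  exists X Y, [/\ X \in cosets, Y \in cosets, X != Y & translation t = tperm X Y].

Definition regular_normalized_in_translations : Prop :=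
  exists N : {group {perm {set gT}}},
    [/\ N \subset perm.Sym cosets, sharply_transitive cosets N,
        translation @: G \subset 'N(N) & N \subset translation @: G].

End Translation.

Section Galois.
Variable k : fieldType.

Definition Galois_closure (M : splittingFieldType k) (E : {subfield M}) : Prop :=
  galois 1 {:M} /\
  forall E' : {subfield M}, (E <= E')%VS -> galois 1 E' -> E' = {:M}%VS :> {vspace M}.

Definition almost_classically_Galois (L : fieldExtType k) : Prop :=
  exists (M : splittingFieldType k) (iota : 'AHom(L, M)),
    Galois_closure (iota @: {:L})%AS /\
    regular_normalized_in_translations
      'Gal({:M} / 1)%G 'Gal({:M} / iota @: {:L})%G.

End Galois.

(* Main.v *)
(* The easy half of Greither-Pareigis theory: let L/k be H-Galois, embedded by *)
(* iota in a Galois extension M/k with group G.  Bijectivity of L (x) H ->     *)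
(* End(L) shows that each embedding g : L -> M is x |-> iota (h x) for a       *)
(* unique h in M (x) H, and h is group-like because g is multiplicative.       *)
(* Hence h permutes all the embeddings, and these permutations form a regular  *)
(* group N of permutations of the cosets which is normalized by G.             *)
(* For (b), let W = NG with point stabilizer S, and let A be the copy of A_6   *)
(* in G.  If M <= N is normal in W and A centralizes N / M, then A meets all   *)
(* conjugates of the image of S in the same subgroup, and so |N : M| <= 2.     *)
(* Hence A, or any element of order 5 of A, must act nontrivially on every     *)
(* such quotient of order > 2.  This is impossible for |N| = [F : k], which    *)
(* divides 720, is a multiple of 3 and is less than 360: count fixed points of *)
(* elements of order 5 on N and on its Sylow subgroups, and use transfer when  *)
(* N has 16 or 36 Sylow 5-subgroups.                                           *)
(* For (a), the even permutations form the required normal complement.         *)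
From HB Require Import structures.
Require Import Defs.
From mathcomp Require Import all_boot all_order all_algebra.
From mathcomp Require Import all_fingroup all_solvable all_field.

Set Implicit Arguments.
Unset Strict Implicit.
Unset Printing Implicit Defensive.

Import GRing.Theory.
Local Open Scope group_scope.

(** * Burnside transfer and group actions *)

(** For (b), a Hopf Galois structure on F/k gives a regular group [N] of permutations of the cosets
    that the translations normalize ([Hopf_Galois_regular_normalized]). Its order is [F : k], a
    multiple of 6 below 360, and [no_regular_normalized] shows that no such [N] exists. The engine
    is [hf_cent_le2]: if the simple group [A] of order 360 centralizes [N], then |N| <= 2. The
    hypotheses pass to quotients ([hf_quotient]), so if M <= N is normal in [W] and one element of
    order 5 of [A] centralizes N / M, then |N : M| <= 2 ([hf_cent_quotient_le2]). Counting Sylow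
    subgroups always produces such an M of larger index, or else Sylow subgroups that [A] must
    normalize ([hf_not_dvd3]). For (a), the transposition is odd, so the even permutations form a
    normal complement of the group that it generates ([regular_normalized_of_transposition]). *)

Section Transfer.
Import FiniteModule.

(** On [P] the transfer to [P] is g |-> g ^ |N : P|, which is injective since p does not divide the
    index. Its kernel is therefore a normal p'-Hall subgroup of index p. *)
Lemma Burnside_prime_transfer (gT : finGroupType) (p : nat) (N P : {group gT}) :
  prime p -> p.-Sylow(N) P -> #|P| = p -> 'N_N(P) \subset 'C(P) ->
  #|N : 'O_p^'(N)| = p.
Proof.
move=> p_pr sylP oP cPN; have sPN := pHall_sub sylP.
have p_gt0 := prime_gt0 p_pr.
have abP : abelian (idm_morphism P @* P).
  by rewrite morphim_idm ?cyclic_abelian ?prime_cyclic ?oP.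
have mP y : y \in P -> y \in (idm_morphism P @* P)%G by rewrite /= morphim_idm.
have genP h : h \in P -> h != 1 -> P :=: <[h]>.
  move=> Ph h1; apply/eqP; rewrite eq_sym eqEcard cycle_subG Ph /= oP -orderE.
  rewrite dvdn_leq ?order_gt0 // -(prime_nt_dvdP p_pr _ (_ : #[h] %| p)) //.
    by rewrite order_eq1.
  by rewrite -oP order_dvdG.
pose V := transfer_morphism N abP.
have trivVP : 'ker V :&: P = 1.
  apply/trivgP/subsetP=> g /setIP[kVg Pg]; rewrite inE.
  apply: contraTT kVg => g1; have Ng := subsetP sPN g Pg.
  have trX := transversalP (rcosets_cycle_partition sPN Ng).
  set X := transversal _ _ in trX.
  rewrite !inE Ng /= (transfer_cycle_expansion sPN abP Ng trX) /=.
  rewrite (eq_bigr (fun x => fmod abP g *+ #|<[g]> : P :* x|)%R); last first.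
    move=> x Xx; set n := #|_ : _|.
    have Nx : x \in N by apply: (subsetP (transversal_sub trX)).
    have Pgnx : (g ^+ n) ^ x^-1 \in P.
      by rewrite conjgE invgK mulgA -mem_rcoset mulg_exp_card_rcosets.
    have Pgn : g ^+ n \in P by rewrite groupX.
    (* If g ^ n is not 1, it and its conjugate both generate [P], so x normalizes [P] and hence
       centralizes it. *)
    have -> : (g ^+ n) ^ x^-1 = g ^+ n.
      have [->|gn1] := eqVneq (g ^+ n) 1; first by rewrite conj1g.
      have nPx : x^-1 \in 'N(P).
        rewrite inE {1}(genP _ Pgn gn1) -cycleJ -(genP _ Pgnx) //.
        by rewrite conjg_eq1.
      have cx : x^-1 \in 'C(P) by rewrite (subsetP cPN) // inE groupV Nx.
      exact/conjg_fixP/commgP/commute_sym/(centP cx).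
    by rewrite /restrm /= /idm fmodX ?mP.
  have -> : (\sum_(x in X) fmod abP g *+ #|<[g]> : P :* x| =
             fmod abP g *+ #|N : P|)%R.
    rewrite -(sum_index_rcosets_cycle sPN Ng trX).
    exact: (GRing.sumrMnr (fmod abP g)).
  apply/eqP => /(congr1 val) /=; rewrite fmvalZ fmodK ?mP // fmval0.
  move/eqP; rewrite -order_dvdn orderE -(genP g) // oP.
  by apply/negP; rewrite -p'natE //; case/and3P: sylP.
have sKN : 'ker V \subset N by apply: subsetIl.
have oN : (#|P| * #|N : P|)%N = #|N| := Lagrange sPN.
have iK : #|N : 'ker V| = p.
  apply/eqP; rewrite eqn_leq; apply/andP; split.
    rewrite -{1}(setIid N) -card_morphim (leq_trans (max_card _)) //.
    rewrite card_sub -oP subset_leq_card //; apply/subsetP=> x.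
    by rewrite inE /= morphim_idm.
  rewrite -(leq_pmul2l (cardG_gt0 ('ker V))) Lagrange // -oP -TI_cardMg //.
  by rewrite subset_leq_card // mul_subG.
have hallK : p^'.-Hall(N) ('ker V).
  rewrite /pHall sKN iK pnatNK pnat_id // andbT /pgroup.
  have := Lagrange sKN; rewrite iK -oN oP mulnC => /eqP.
  by rewrite eqn_pmul2l // => /eqP->; case/and3P: sylP.
by rewrite (normal_Hall_pcore hallK (ker_normal V)).
Qed.

End Transfer.

Lemma order5_fix_mod (gT : finGroupType) (U T : {group gT}) :
  #|U| = 5 -> U \subset 'N(T) -> #|T| = #|'C_T(U)| %[mod 5].
Proof.
move=> oU nTU; rewrite -afixJ -pgroup_fix_mod // ?astabsJ //.
by rewrite /pgroup oU.
Qed.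

(** The order of the centralizer divides |T| and is congruent to |T| modulo 5; for the listed orders
    this leaves only |T|. *)
Lemma order5_cent (gT : finGroupType) (U T : {group gT}) :
  #|U| = 5 -> U \subset 'N(T) -> #|T| \in [:: 1; 2; 3; 4; 5; 8; 9]%N ->
  T \subset 'C(U).
Proof.
move=> oU nTU oT; suff : #|'C_T(U)| == #|T|.
  by move=> /eqP oC; apply/setIidPl/eqP; rewrite eqEcard subsetIl oC leqnn.
have t_gt0 := cardG_gt0 T; have /eqP eqc := order5_fix_mod oU nTU.
have : all (fun t => all (fun c => (t == c %[mod 5]) ==> (c == t)) (divisors t))
  [:: 1; 2; 3; 4; 5; 8; 9]%N by [].
move/allP/(_ _ oT)/allP/(_ #|'C_T(U)|); rewrite eqc /=; apply.
by rewrite -dvdn_divisors // cardSg ?subsetIl.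
Qed.

(** Modulo the pointwise stabilizer, [G] embeds in the symmetric group on [S]. *)
Lemma index_astab_dvd_fact (aT : finGroupType) (rT : finType)
    (to : {action aT &-> rT}) (G : {group aT}) (S : {set rT}) :
  [acts G, on S | to] -> #|G : 'C_G(S | to)| %| #|S|`!.
Proof.
move=> actsG.
have nSG x : x \in G -> actperm to x \in 'N(S | 'P).
  by move=> Gx; apply/astabsP=> y; rewrite /= apermE actpermE (acts_act actsG).
pose f := comp_morphism (actperm_morphism to) (restr_perm_morphism S).
have sG : G \subset actperm to @*^-1 'N(S | 'P).
  by apply/subsetP=> x Gx; apply/morphpreP; rewrite inE nSG.
have : #|f @* G| %| #|S|`!.
  rewrite -perm.card_Sym cardSg //; apply/subsetP=> _ /morphimP[x _ _ ->].
  by rewrite inE /= restr_perm_on.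
apply: dvdn_trans; rewrite card_morphim (setIidPr sG) -(indexgI G ('ker f)).
rewrite indexgS // subsetI subsetIl; apply/subsetP=> x /setIP[Gx /mker fx1].
apply/astabP=> y Sy; have := congr1 (fun s : {perm rT} => s y) fx1.
by rewrite /= restr_permE ?nSG // actpermE perm1.
Qed.

(** The group that [K] induces on [P] has order dividing both |Aut P| = 4 and, since [P] is abelian,
    the odd number |K : P|. *)
Lemma odd_index_cent5 (gT : finGroupType) (K P : {group gT}) :
  #|P| = 5 -> K \subset 'N(P) -> P \subset K -> odd #|K : P| -> K \subset 'C(P).
Proof.
move=> oP nPK sPK odd_i.
have cycP : cyclic P by rewrite prime_cyclic ?oP.
have dvd4 : #|conj_aut P @* K| %| 4.
  have : totient #|P| = 4 by rewrite oP.
  rewrite -card_Aut_cyclic // => <-; rewrite cardSg //.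
  exact: Aut_conj_aut.
rewrite -indexg_eq1; move: dvd4.
rewrite card_morphim (setIidPr nPK) ker_conj_aut => dvd4.
have dvdi : #|K : 'C(P)| %| #|K : P|.
  rewrite -(indexgI K 'C(P)) indexgS // subsetI sPK.
  by rewrite -abelianE cyclic_abelian.
have : coprime #|K : 'C(P)| #|K : 'C(P)|.
  rewrite (coprime_dvdl dvd4) // (coprime_dvdr dvdi) // -[4]/(2 ^ 2)%N.
  by rewrite coprime_pexpl // coprime2n.
by rewrite /coprime gcdnn.
Qed.

(** * Regular subgroups normalized by an extension of A_6 *)

(* W acts on W / S: N is regular and G is transitive. *)
Record holomorph_factorization (gT : finGroupType) (W N S G A : {group gT}) :
  Prop := HolomorphFactorization {
  hf_normal : N <| W;
  hf_NG : N * G = W;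
  hf_NS : N * S = W;
  hf_SG : S * G = W;
  hf_TI : N :&: S = 1;
  hf_normalA : A <| G;
  hf_indexA : #|G : A| <= 2;
  hf_simpleA : simple A;
  hf_cardA : #|A| = 360;
  hf_cardN : #|N| < 360
}.

Section HolomorphFactorization.
Variables (gT : finGroupType) (W N S G A : {group gT}).
Hypothesis hf : holomorph_factorization W N S G A.

Let sAG : A \subset G. Proof. exact: normal_sub (hf_normalA hf). Qed.
Let sGW : G \subset W. Proof. by rewrite -(hf_NG hf) mulG_subr. Qed.
Let sAW : A \subset W. Proof. exact: subset_trans sGW. Qed.
Let nNW : W \subset 'N(N). Proof. exact: normal_norm (hf_normal hf). Qed.
Let nNA : A \subset 'N(N). Proof. exact: subset_trans nNW. Qed.
Let oW : #|W| = (#|N| * #|S|)%N.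
Proof. by rewrite -(hf_NS hf) TI_cardMg ?(hf_TI hf). Qed.

Lemma hf_normal_simple (B : {group gT}) : B <| A -> B :=: 1 \/ B :=: A.
Proof. by have /simpleP[_ simA] := hf_simpleA hf; apply: simA. Qed.

Lemma hf_TI_NA : N :&: A = 1.
Proof.
have /hf_normal_simple[//|/setIidPr/subset_leq_card] : N :&: A <| A.
  by rewrite /normal subsetIr normsI ?normG.
by rewrite (hf_cardA hf) leqNgt (hf_cardN hf).
Qed.

(* If N centralizes A, then A meets all conjugates of S in the same subgroup.  *)
Lemma hf_cent_le2 : A \subset 'C(N) -> #|N| <= 2.
Proof.
move=> cNA; have: A :&: S <| A.
  rewrite /normal subsetIl; apply/subsetP=> a Aa; rewrite inE.
  have SNW : S * N = W.
    rewrite normC ?(hf_NS hf) // (subset_trans _ nNW) //.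
    by rewrite -(hf_NS hf) mulG_subr.
  have := subsetP sAW a Aa; rewrite -SNW => /mulsgP[s v Ss Nv Da].
  have cNv (B : {set gT}) : B \subset A -> B :^ v = B.
    move=> sBA; apply/normP; apply: subsetP (v) Nv.
    by rewrite (subset_trans _ (cent_sub _)) // centsC (subset_trans sBA).
  (* With a = s v, both sides equal [A :&: S :^ v], because v centralizes [A] and s lies in [S]. *)
  rewrite (_ : (A :&: S) :^ a = A :&: S) //.
  rewrite -[RHS]cNv ?subsetIl // !conjIg (conjGid Aa) cNv //.
  by rewrite Da conjsgM (conjGid Ss).
have S_gt0 := cardG_gt0 S.
(* A trivial intersection gives |A| |S| <= |W| = |N| |S|, against |N| < 360. Otherwise [A] lies in
   [S :&: G], whose index in [G] is |N|. *)
case/hf_normal_simple=> [tiAS | /setIidPl sAS].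
  have: #|A * S| <= #|W|.
    by rewrite subset_leq_card // mul_subG // -(hf_NS hf) mulG_subr.
  by rewrite TI_cardMg // oW (hf_cardA hf) leq_pmul2r // leqNgt (hf_cardN hf).
have := mul_cardG S G; rewrite (hf_SG hf) oW mulnAC [X in X = _]mulnC => /eqP.
rewrite eqn_pmul2r // => /eqP oG.
have I_gt0 := cardG_gt0 (S :&: G).
rewrite -(leq_pmul2r I_gt0) -oG -(Lagrange sAG) mulnC.
apply: leq_mul (hf_indexA hf) _.
by rewrite subset_leq_card // subsetI sAS.
Qed.

Lemma hf_quotient (M : {group gT}) : M <| W -> M \subset N ->
  holomorph_factorization (W / M) (N / M) (S / M) (G / M) (A / M).
Proof.
case/andP=> sMW nMW sMN.
have sNW := normal_sub (hf_normal hf).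
have sSW : S \subset W by rewrite -(hf_NS hf) mulG_subr.
have nM (B : {set gT}) : B \subset W -> B \subset 'N(M).
  by move=> sBW; apply: subset_trans nMW.
have isoA : A \isog A / M.
  rewrite quotient_isog ?nM //; apply/trivgP.
  by rewrite -hf_TI_NA setSI.
split=> /=.
- exact: quotient_normal (hf_normal hf).
- by rewrite -quotientMl ?nM // (hf_NG hf).
- by rewrite -quotientMl ?nM // (hf_NS hf).
- by rewrite -quotientMl ?nM // (hf_SG hf).
- by rewrite -quotientGI // (hf_TI hf) quotient1.
- exact: quotient_normal (hf_normalA hf).
- apply: leq_trans (hf_indexA hf); rewrite dvdn_leq // index_quotient //.
  by rewrite nM // subIset ?sGW.
- by rewrite -(isog_simple isoA) (hf_simpleA hf).
- by rewrite -(card_isog isoA) (hf_cardA hf).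
- exact: leq_ltn_trans (leq_quotient _ _) (hf_cardN hf).
Qed.

(** The centralizer of [N] in [A] is normal in [A], so it is all of [A] once it contains some u !=
    1. *)
Lemma hf_cent_elt_le2 u : u \in A -> u != 1 -> N \subset 'C[u] -> #|N| <= 2.
Proof.
move=> Au u1 cuN.
have /hf_normal_simple[C1|CA] : 'C_A(N) <| A.
  by rewrite /normal subsetIl normsI ?normG ?norms_cent.
  by move/setP/(_ u): C1; rewrite !inE Au -sub_cent1 cuN (negPf u1).
by apply: hf_cent_le2; rewrite -CA subsetIr.
Qed.

End HolomorphFactorization.

(** * Action of [A] on the Sylow subgroups of [N]; orders dividing 144 *)

Section Sylow.
Variables (gT : finGroupType) (W N S G A : {group gT}).
Hypothesis hf : holomorph_factorization W N S G A.

Let sAG : A \subset G. Proof. exact: normal_sub (hf_normalA hf). Qed.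
Let sGW : G \subset W. Proof. by rewrite -(hf_NG hf) mulG_subr. Qed.
Let sAW : A \subset W. Proof. exact: subset_trans sGW. Qed.
Let nNW : W \subset 'N(N). Proof. exact: normal_norm (hf_normal hf). Qed.
Let nNA : A \subset 'N(N). Proof. exact: subset_trans nNW. Qed.

(* A centralizes N / [N, A], and [N, A] normalizes every Sylow subgroup. *)
Lemma hf_norm_Sylow p :
    (forall P : {group gT}, p.-Sylow(N) P -> A \subset 'N(P)) ->
  #|'Syl_p(N)| <= 2.
Proof.
move=> nSA; have [P sylP] := Sylow_exists p N.
have sNW := normal_sub (hf_normal hf).
have nsRW : [~: N, A] <| W.
  rewrite /normal (subset_trans _ sNW) ?commg_subl //=.
  rewrite -(hf_NG hf) mul_subG ?commg_norml ?normsR //.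
    exact: subset_trans nNW.
  exact: normal_norm (hf_normalA hf).
have sRN : [~: N, A] \subset N by rewrite commg_subl.
have iR : #|N : [~: N, A]| <= 2.
  rewrite -card_quotient ?commg_norml //.
  apply: (hf_cent_le2 (hf_quotient hf nsRW sRN)).
  by rewrite quotient_cents2r // commGC.
apply: leq_trans iR; rewrite (card_Syl sylP) dvdn_leq // indexgS // subsetI sRN.
rewrite gen_subG; apply/subsetP=> _ /imset2P[x a Nx Aa ->].
have nPa (Q : {group gT}) : p.-Sylow(N) Q -> a \in 'N(Q).
  by move/nSA/subsetP; apply.
(* The commutator is (a^-1)^x * a; its first factor normalizes [P] because [a] normalizes the Sylow
   subgroup P ^ x^-1. *)
rewrite commgEr groupM ?nPa //= -mem_conjgV -normJ groupV.
by apply: (nPa (P :^ x^-1)%G); rewrite pHallJ ?groupV.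
Qed.

Lemma hf_char_normal (M : {group gT}) : M \char N -> M <| W.
Proof. by move=> chMN; apply: char_normal_trans chMN (hf_normal hf). Qed.

Lemma hf_exists_order5 : exists2 u, u \in A & #[u] = 5.
Proof.
have [//||u Au ou] := @Cauchy _ 5 A; first by rewrite (hf_cardA hf).
by exists u.
Qed.

Lemma hf_cent_quotient_le2 u (M : {group gT}) :
  u \in A -> #[u] = 5 -> M <| W -> M \subset N -> N / M \subset 'C(<[u]> / M) ->
  #|N : M| <= 2.
Proof.
move=> Au ou nsMW sMN cuN; have nMW := normal_norm nsMW.
have hfM := hf_quotient hf nsMW sMN.
have nMu : u \in 'N(M) by rewrite (subsetP nMW) ?(subsetP sAW).
rewrite -card_quotient ?(subset_trans _ nMW) ?(normal_sub (hf_normal hf)) //.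
apply: (hf_cent_elt_le2 hfM (mem_quotient M Au)); last first.
  by move: cuN; rewrite quotient_cycle // cent_cycle.
apply/eqP=> /coset_idr-/(_ nMu) Mu.
have : u \in N :&: A by rewrite inE Au (subsetP sMN).
by rewrite (hf_TI_NA hf) inE -order_eq1 ou.
Qed.

(** The conjugates of [u] generate [A], and conjugation by [A] permutes the Sylow subgroups of
    [N]. *)
Lemma hf_norm_all_Sylow u p : u \in A -> u != 1 ->
    (forall P : {group gT}, p.-Sylow(N) P -> u \in 'N(P)) ->
  forall P : {group gT}, p.-Sylow(N) P -> A \subset 'N(P).
Proof.
move=> Au u1 nPu P sylP.
have /(hf_normal_simple hf)[K1|KA] : <<u ^: A>>%G <| A.
- by rewrite /normal gen_subG class_subG ?norms_gen ?class_norm.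
- by move: (mem_gen (class_refl A u)); rewrite [<<_>>]K1 inE (negPf u1).
rewrite -KA gen_subG; apply/subsetP=> _ /imsetP[a Aa ->].
rewrite -mem_conjgV -normJ; apply: (nPu (P :^ a^-1)%G).
by rewrite -(normP (subsetP nNA _ (groupVr Aa))) pHallJ2.
Qed.

(** By coprime action, [u] of order 5 normalizes a Sylow 2-subgroup [T] and a Sylow 3-subgroup [R],
    and it centralizes [R] because |R| divides 9. All Sylow 2-subgroups are conjugates of [T] under
    [R], so [u], and then [A], normalizes each of them. Hence [T] is normal, [u] centralizes N / T,
    and |N : T| <= 2. *)
Lemma hf_not_dvd3_of_dvd144 : #|N| %| 144 -> ~~ (3 %| #|N|).
Proof.
move=> oN; apply/negP=> dvd3N.
have [u Au ou] := hf_exists_order5.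
have u1 : u != 1 by rewrite -order_eq1 ou.
have oU : #|<[u]>| = 5 by [].
have nNU : <[u]> \subset 'N(N) by rewrite cycle_subG (subsetP nNA).
have coNU : coprime #|N| #|<[u]>|.
  by rewrite oU coprime_sym (coprime_dvdr oN).
have solU : solvable <[u]> by rewrite abelian_sol ?cycle_abelian.
have [T sylT nTU] := @sol_coprime_Sylow_exists _ 2 _ _ solU nNU coNU.
have [R sylR nRU] := @sol_coprime_Sylow_exists _ 3 _ _ solU nNU coNU.
have e2 : (144`_2)%N = 16 by rewrite p_part.
have e3 : (144`_3)%N = 9 by rewrite p_part.
have e2' : (144`_2^')%N = 9.
  by apply/eqP; rewrite -(eqn_pmul2l (isT : 0 < 16)) -{1}e2 partnC.
have dvdT : #|T| %| 16 by rewrite (card_Hall sylT) -e2 partn_dvd.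
have dvdR : #|R| %| 9 by rewrite (card_Hall sylR) -e3 partn_dvd.
have cRU : R \subset 'C(<[u]>).
  apply: order5_cent => //; move: dvdR; rewrite dvdn_divisors //.
  by rewrite (_ : divisors 9 = [:: 1; 3; 9]%N) // !inE => /or3P[]/eqP->.
have coTR : coprime #|T| #|R|.
  by rewrite (coprime_dvdl dvdT) ?(coprime_dvdr dvdR).
have defN : T * R = N.
  apply/eqP; rewrite eqEcard mul_subG ?(pHall_sub sylT) ?(pHall_sub sylR) //=.
  rewrite coprime_cardMg // (card_Hall sylT) (card_Hall sylR).
  rewrite -{1}(partnC 2 (cardG_gt0 N)) leq_mul // dvdn_leq ?part_gt0 //.
  rewrite -[X in X %| _](@part_pnat_id 3) ?partn_dvd ?dvdn_part //.
  by apply: (@pnat_dvd _ 9) => //; rewrite -e2' partn_dvd.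
have nSylU (P : {group gT}) : 2.-Sylow(N) P -> u \in 'N(P).
  move=> sylP; have [n Nn ->] := Sylow_trans sylT sylP.
  move: Nn; rewrite -defN => /mulsgP[t r Tt Rr ->].
  rewrite /= conjsgM (conjGid Tt) normJ mem_conjg -cycle_subG.
  suff -> : u ^ r^-1 = u by [].
  apply/conjg_fixP/commgP/commute_sym; red.
  by apply: (centsP cRU); rewrite ?groupV ?cycle_id.
have nTN : T <| N.
  rewrite /normal (pHall_sub sylT); apply/setIidPl/eqP.
  rewrite eqEcard subsetIl -(Lagrange (subsetIl N 'N(T))) -(card_Syl sylT).
  (* The number of Sylow 2-subgroups is odd and at most 2. *)
  have := hf_norm_Sylow (hf_norm_all_Sylow Au u1 nSylU).
  have := card_Syl_mod N (isT : prime 2).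
  by case: #|_| => [|[|[|c]]] //; rewrite muln1 leqnn.
have chT : T \char N by rewrite -(normal_Hall_pcore sylT nTN) pcore_char.
have : #|N : T| <= 2.
  apply: (hf_cent_quotient_le2 Au ou (hf_char_normal chT) (normal_sub nTN)).
  by rewrite -defN quotientMidl quotient_cents.
have : 3 %| #|N : T|.
  rewrite -(Gauss_dvdr _ (_ : coprime 3 #|T|)) ?Lagrange ?normal_sub //.
  by rewrite coprime_sym (coprime_dvdl dvdT).
by case: #|N : T| (indexg_gt0 N T) => [|[|[|c]]].
Qed.

End Sylow.

(** * Sylow 5-subgroups of [N] *)

Section NotDivisibleBy3.
Variables (gT : finGroupType) (W N S G A : {group gT}).
Hypothesis hf : holomorph_factorization W N S G A.

Let sAG : A \subset G. Proof. exact: normal_sub (hf_normalA hf). Qed.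
Let sGW : G \subset W. Proof. by rewrite -(hf_NG hf) mulG_subr. Qed.
Let sAW : A \subset W. Proof. exact: subset_trans sGW. Qed.
Let nNW : W \subset 'N(N). Proof. exact: normal_norm (hf_normal hf). Qed.
Let nNA : A \subset 'N(N). Proof. exact: subset_trans nNW. Qed.

Lemma hf_cardG : #|G| = (#|N| * #|S :&: G|)%N.
Proof.
have := mul_cardG S G.
rewrite (hf_SG hf) -(hf_NS hf) TI_cardMg ?(hf_TI hf) //.
by rewrite mulnAC [X in X = _]mulnC => /eqP; rewrite eqn_pmul2r // => /eqP.
Qed.

Lemma hf_dvd720 : #|N| %| 720.
Proof.
have dvdG : #|N| %| #|G| by rewrite hf_cardG dvdn_mulr.
apply: dvdn_trans dvdG _; rewrite -(Lagrange sAG) (hf_cardA hf).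
rewrite -[720]/(360 * 2)%N dvdn_pmul2l //.
by case: #|G : A| (indexg_gt0 G A) (hf_indexA hf) => [|[|[|c]]].
Qed.

(** Transfer gives a quotient of [N] of order 5, which an element of order 5 can only centralize. *)
Lemma hf_Syl5_not_odd_index (P : {group gT}) :
  5.-Sylow(N) P -> #|P| = 5 -> odd #|'N_N(P) : P| -> False.
Proof.
move=> sylP oP odd_i; have sPN := pHall_sub sylP.
have iM : #|N : 'O_5^'(N)| = 5.
  apply: (Burnside_prime_transfer _ sylP oP) => //.
  apply: (odd_index_cent5 oP) odd_i; first exact: subsetIr.
  by rewrite subsetI sPN normG.
have [u Au ou] := hf_exists_order5 hf.
have nsMW := hf_char_normal hf (pcore_char 5^' N).
have sMN := pcore_sub 5^' N.
have nMu : <[u]> \subset 'N('O_5^'(N)).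
  by rewrite (subset_trans _ (normal_norm nsMW)) // cycle_subG (subsetP sAW).
suff : #|N : 'O_5^'(N)| <= 2 by rewrite iM.
apply: (hf_cent_quotient_le2 hf Au ou nsMW sMN).
apply: order5_cent; last by rewrite card_quotient ?gFnorm // iM.
  rewrite -(card_isog (quotient_isog nMu _)) //; apply/trivgP.
  by rewrite -(hf_TI_NA hf) setISS // cycle_subG.
by rewrite quotient_norms // (subset_trans _ nNA) // cycle_subG.
Qed.

(** [W] permutes the six subgroups through a group of order dividing 720. If [A] acts faithfully, it
    is too large to lie in the image of [N], whose order is a multiple of 6, and meeting it
    trivially would need more than 720 elements. Otherwise [A] normalizes all six, against
    [hf_norm_Sylow]. *)
Lemma hf_Syl5_neq6 : #|'Syl_5(N)| = 6 -> False.
Proof.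
move=> s6.
have actW : [acts W, on 'Syl_5(N) | 'JG].
  apply/actsP=> x Wx Q /=.
  by rewrite !inE -{1}(normsP nNW x Wx) pHallJ2.
pose K := 'C_W('Syl_5(N) | 'JG)%G.
have nsKW : K <| W.
  by rewrite /normal subsetIl normsI ?normG // (subset_trans actW) ?astab_norm.
have sNW := normal_sub (hf_normal hf).
have nKW := normal_norm nsKW.
have nKA := subset_trans sAW nKW.
have nKN := subset_trans sNW nKW.
have oWK : #|W / K| %| 720.
  by rewrite card_quotient // (dvdn_trans (index_astab_dvd_fact actW)) // s6.
have Knorm (P : {group gT}) : 5.-Sylow(N) P -> K \subset 'N(P).
  move=> sylP; apply/subsetP=> x /setIP[_ /astabP/(_ P)].
  rewrite inE => /(_ sylP) /(congr1 val) /= nPx.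
  by rewrite inE nPx.
have [P sylP] := Sylow_exists 5 N.
have NK6 : 6 %| #|N / K|.
  rewrite -s6 (card_Syl sylP) card_quotient // -(indexgI N K) indexgS //.
  by rewrite setIS ?Knorm.
have /(hf_normal_simple hf)[tiAK|/setIidPl sAK] : A :&: K <| A.
- by rewrite /normal subsetIl normsI ?normG.
- have isoA := quotient_isog nKA (etrans (setIC _ _) tiAK).
  have /simpleP[_ simA] : simple (A / K).
    by rewrite -(isog_simple isoA) (hf_simpleA hf).
  have /simA[tiNA|/setIidPr sAN] : N / K :&: A / K <| A / K.
  + by rewrite /normal subsetIr normsI ?normG // quotient_norms.
  + have : #|N / K * (A / K)| <= 720.
      rewrite (leq_trans _ (dvdn_leq _ oWK)) // subset_leq_card //.
      by rewrite mul_subG ?quotientS.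
    rewrite TI_cardMg // -(card_isog isoA) (hf_cardA hf).
    rewrite -[720]/(2 * 360)%N leq_pmul2r //.
    by rewrite leqNgt (leq_trans _ (dvdn_leq _ NK6)).
  have := subset_leq_card sAN.
  rewrite -(card_isog isoA) (hf_cardA hf) leqNgt => /negP[].
  exact: leq_ltn_trans (leq_quotient _ _) (hf_cardN hf).
have nSA (Q : {group gT}) : 5.-Sylow(N) Q -> A \subset 'N(Q).
  by move/Knorm; apply: subset_trans.
by have := hf_norm_Sylow hf nSA; rewrite s6.
Qed.

Theorem hf_not_dvd3 : ~~ (3 %| #|N|).
Proof.
apply/negP=> dvd3N.
have [dvd5N|ndvd5N] := boolP (5 %| #|N|); last first.
  have /negP[//] : ~~ (3 %| #|N|).
  apply: (hf_not_dvd3_of_dvd144 hf).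
  rewrite -(@Gauss_dvdr _ 5) ?hf_dvd720 //.
  by rewrite coprime_sym prime_coprime.
have [P sylP] := Sylow_exists 5 N; have sPN := pHall_sub sylP.
have e5 : (720`_5)%N = 5 by rewrite p_part.
have oP : #|P| = 5.
  apply/eqP; rewrite (card_Hall sylP) eqn_dvd; apply/andP; split.
    by rewrite -[X in _ %| X]e5 partn_dvd ?hf_dvd720.
  by rewrite -[X in X %| _](@part_pnat_id 5) ?partn_dvd.
set r := #|N : P|; have oN : #|N| = (5 * r)%N by rewrite -oP Lagrange.
have r144 : r %| 144.
  by have := hf_dvd720; rewrite oN -[720]/(5 * 144)%N dvdn_pmul2l.
have r72 : r < 72.
  by have := hf_cardN hf; rewrite oN -[360]/(5 * 72)%N ltn_pmul2l.
have rE : r = (#|'N_N(P) : P| * #|'Syl_5(N)|)%N.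
  rewrite (card_Syl sylP) mulnC Lagrange_index ?subsetIl //.
  by rewrite subsetI sPN normG.
set s := #|'Syl_5(N)| in rE.
have smod : s %% 5 = 1%N := card_Syl_mod N (isT : prime 5).
(* These are the divisors of 144 congruent to 1 modulo 5. *)
have : s \in [:: 1; 6; 16; 36]%N.
  have : all (fun s => (s %% 5 == 1%N) ==> (s \in [:: 1; 6; 16; 36]%N))
    (divisors 144) by [].
  move/allP/(_ s); rewrite smod eqxx; apply.
  by rewrite -dvdn_divisors // (dvdn_trans _ r144) // rE dvdn_mull.
have sNW := normal_sub (hf_normal hf).
have [u Au ou] := hf_exists_order5 hf.
rewrite !inE => /or4P[] /eqP s_eq.
(* Divide by the normal subgroup [P]: the order [r] of the quotient divides 144 and is still a
   multiple of 3. *)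
- have nPN : P <| N.
    rewrite /normal sPN; apply/setIidPl/eqP.
    rewrite eqEcard subsetIl -(Lagrange (subsetIl N 'N(P))) -(card_Syl sylP).
    by rewrite -/s s_eq muln1 leqnn.
  have chP : P \char N by rewrite -(normal_Hall_pcore sylP nPN) pcore_char.
  have hfP := hf_quotient hf (hf_char_normal hf chP) sPN.
  have oNP : #|N / P| = r by rewrite card_quotient ?normal_norm.
  have := hf_not_dvd3_of_dvd144 hfP; rewrite oNP => /(_ r144)/negP; apply.
  by move: dvd3N; rewrite oN Gauss_dvdr.
- exact: hf_Syl5_neq6 s_eq.
(* Here r = 16 i divides 144 and is below 72, so i is 1 or 3. *)
- apply: (hf_Syl5_not_odd_index sylP oP).
  by move: r144 r72; rewrite rE s_eq; case: #|_ : P| => [|[|[|[|[|c]]]]].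
(* Here r = 36 i is below 72, so i = 1. *)
- apply: (hf_Syl5_not_odd_index sylP oP).
  by move: r144 r72; rewrite rE s_eq; case: #|_ : P| => [|[|c]].
Qed.
End NotDivisibleBy3.

(** * Regular subgroups normalized by translations *)

Lemma Sym_closed (T : finType) (S : {set T}) (s : {perm T}) x :
  s \in perm.Sym S -> (s x \in S) = (x \in S).
Proof. by rewrite inE => /perm_closed->. Qed.

Section TranslationMorphism.
Variables (gT : finGroupType) (G H : {group gT}).

Lemma rcosets_closed g X : g \in G -> X \in cosets G H -> X :* g \in cosets G H.
Proof.
move=> Gg /rcosetsP[x Gx ->]; rewrite -rcosetM; apply/rcosetsP.
by exists (x * g); rewrite ?groupM.
Qed.

Lemma translationM : {in G &, {morph translation G H : x y / x * y}}.
Proof.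
move=> x y Gx Gy; apply/permP=> X; rewrite permM.
have [SX|nSX] := boolP (X \in cosets G H).
  by rewrite !translationE ?groupM ?rcosets_closed // rcosetM.
by rewrite !(out_perm (translation_on _ _ _)).
Qed.

Canonical translation_morphism := Morphism translationM.

Lemma translation_coset_id g :
  g \in G -> (translation G H g H == H) = (g \in H).
Proof.
move=> Gg; rewrite translationE //; last first.
  by rewrite -[X in X \in _]rcoset1 -rcosetE imset_f.
by apply/eqP/idP=> [e|/rcoset_id//]; have := rcoset_refl H g; rewrite e.
Qed.

(** [N] and the translations generate a group that, with the stabilizer of the coset [H], forms a
    [holomorph_factorization]. *)
Lemma no_regular_normalized (A : {group gT}) (N : {group {perm {set gT}}}) :
  A <| G -> #|G : A| <= 2 -> simple A -> #|A| = 360 -> H \subset G ->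
  3 %| #|G : H| -> #|G : H| < 360 ->
  N \subset perm.Sym (cosets G H) -> translation G H @: G \subset 'N(N) ->
  ~ sharply_transitive (cosets G H) N.
Proof.
move=> nsAG iA simA oA sHG dvd3 lt360 sNS nNG stN.
have sAG := normal_sub nsAG.
pose f := translation_morphism.
have fG : f @* G = translation G H @: G by rewrite morphimEdom.
have HC : (H : {set gT}) \in cosets G H.
  by rewrite -[X in X \in _]rcoset1 -rcosetE imset_f.
pose W := (N <*> f @* G)%G.
pose S := 'C_W[H : {set gT} | 'P]%G.
have sWS : W \subset perm.Sym (cosets G H).
  rewrite join_subG sNS fG; apply/subsetP=> _ /imsetP[g Gg ->].
  by rewrite inE translation_on.
have defW : N * f @* G = W.
  by rewrite /W /= norm_joinEr //; move: nNG; rewrite -fG.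
have sNW : N \subset W := joing_subl _ _.
have sGW : f @* G \subset W := joing_subr _ _.
have memS w : w \in W -> w H = H -> w \in S.
  by move=> Ww wH; apply/setIP; split=> //; apply/astab1P.
have nsNW : N <| W by rewrite /normal sNW join_subG normG fG.
have transS (B : {group {perm {set gT}}}) : B \subset W ->
    (forall X, X \in cosets G H -> exists2 b, b \in B & b H = X) -> S * B = W.
  move=> sBW trB; apply/eqP; rewrite eqEsubset mul_subG ?subsetIl //=.
  apply/subsetP=> w Ww.
  have [|b Bb bH] := trB (w H); first by rewrite Sym_closed ?(subsetP sWS).
  rewrite -(mulgKV b w) mem_mulg // memS ?permM -?bH ?permK //.
  by rewrite groupM ?groupV // (subsetP sBW).
have oN : #|N| = #|G : H|.
  change (#|N| = #|cosets G H|).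
  have <- : (fun n : {perm {set gT}} => n (H : {set gT})) @: N = cosets G H.
    apply/setP=> X; apply/imsetP/idP=> [[n Nn ->]|CX].
      by rewrite Sym_closed ?(subsetP sNS).
    by have [n [[Nn <-] _]] := stN _ _ HC CX; exists n.
  rewrite card_in_imset // => n m Nn Nm /= enm.
  have CX : n H \in cosets G H by rewrite Sym_closed ?(subsetP sNS).
  by have [s [_ us]] := stN _ _ HC CX; rewrite -(us n) // -(us m).
have trN : S * N = W.
  apply: transS sNW _ => X CX; have [n [[Nn nH] _]] := stN _ _ HC CX.
  by exists n.
(* If [A] acted trivially it would lie in [H], giving |G : H| <= 2. *)
have tiA : A :&: 'ker f = 1.
  have /simpleP[_ simA'] := simA.
  have /simA'[//|/setIidPl sAK] : A :&: 'ker f <| A.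
    rewrite /normal subsetIl normsI ?normG //.
    by rewrite (subset_trans sAG) ?(ker_norm f).
  have sAH : A \subset H.
    apply/subsetP=> a Aa; rewrite -translation_coset_id ?(subsetP sAG) //.
    by rewrite (mker (subsetP sAK a Aa)) perm1.
  have := leq_trans (dvdn_leq (indexg_gt0 G A) (indexgS G sAH)) iA.
  by move: dvd3 (indexg_gt0 G H); case: #|G : H| => [|[|[|c]]].
have injA : A \isog f @* A.
  have injr : 'injm (restrm sAG f) by rewrite ker_restrm tiA.
  by have := sub_isog (subxx A) injr; rewrite morphim_restrm setIid.
have hf : holomorph_factorization W N S (f @* G) (f @* A).
  split=> //.
  - by rewrite -normC // (subset_trans _ (normal_norm nsNW)) ?subsetIl.
  - apply: transS sGW _ => _ /rcosetsP[x Gx ->].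
    by exists (f x); rewrite ?mem_morphim //= translationE.
  - apply/trivgP/subsetP=> n /setIP[Nn /setIP[_ /astab1P nH]].
    have [m [_ uniqm]] := stN _ _ HC HC.
    by rewrite inE -(uniqm n) // -(uniqm 1) ?group1 ?perm1.
  - exact: morphim_normal.
  - by rewrite (leq_trans _ iA) // dvdn_leq // index_morphim ?subsetIl.
  - by rewrite -(isog_simple injA).
  - by rewrite -(card_isog injA).
  - by rewrite oN.
by have := hf_not_dvd3 hf; rewrite oN dvd3.
Qed.

End TranslationMorphism.

Lemma isog_S6_simple_subgroup (gT : finGroupType) (G : {group gT}) :
  G \isog [set: 'S_6] -> exists A : {group gT},
    [/\ A <| G, #|G : A| <= 2, simple A & #|A| = 360].
Proof.
rewrite isog_sym => /isogP[f injf fG].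
have card6 : #|'I_6| = 6 := card_ord 6.
exists (f @* 'Alt_('I_6))%G; rewrite -fG; split=> /=.
- exact: morphim_normal (Alt_normal _).
- by rewrite index_injm ?subsetT // Alt_index ?card6.
- by rewrite -(isog_simple (sub_isog (subsetT _) injf)) simple_Alt5 ?card6.
rewrite card_injm ?subsetT //; apply/eqP.
by rewrite -(eqn_pmul2l (isT : 0 < 2)) card_Alt card6.
Qed.

Lemma card_gal_cosets (k : fieldType) (M : splittingFieldType k)
    (F : {subfield M}) :
  galois 1 {:M} -> #|'Gal({:M} / 1) : 'Gal({:M} / F)| = \dim F.
Proof.
move=> gal1.
have galF : galois F {:M} by apply: galoisS gal1; rewrite sub1v subvf.
have sFG : 'Gal({:M} / F) \subset 'Gal({:M} / 1) by rewrite galS ?sub1v.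
have dvdF : \dim F %| \dim {:M} by rewrite field_dimS ?subvf.
apply/eqP; rewrite -(eqn_pmul2l (cardG_gt0 'Gal({:M} / F))) Lagrange //.
by rewrite -!galois_dim // dimv1 divn1 divnK.
Qed.

(** The elements acting evenly on the cosets of [J] form a normal subgroup. As [t] acts oddly, each
    coset of [H] = {1, t} contains exactly one of them, so they act regularly on these cosets. *)
Lemma regular_normalized_of_transposition (gT : finGroupType)
    (G J H : {group gT}) t :
  t \in G -> #[t] = 2 -> H :=: <[t]> -> translation_transposition G J t ->
  regular_normalized_in_translations G H.
Proof.
move=> Gt t2 HE [X [Y [_ _ nXY tXY]]].
pose A := [set g in G | ~~ odd_perm (translation G J g)].
have gA : group_set A.
  apply/group_setP; split=> [|x y].
    by rewrite inE group1 (morph1 (translation_morphism G J)) odd_perm1.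
  rewrite !inE => /andP[Gx ox] /andP[Gy oy].
  by rewrite groupM // translationM // odd_permM (negPf ox) (negPf oy).
have odd_t : odd_perm (translation G J t) by rewrite tXY odd_tperm nXY.
have sAG : A \subset G by apply/subsetP=> x; rewrite inE => /andP[].
have nAG : G \subset 'N(A).
  apply/subsetP=> x Gx; rewrite inE; apply/subsetP=> z /imsetP[y].
  rewrite !inE => /andP[Gy oy] ->; rewrite groupJ //=.
  by rewrite (morphJ (translation_morphism G J)) // odd_permJ.
pose f := translation_morphism G H.
have fG : translation G H @: G = f @* G by rewrite morphimEdom.
have Ht : t \in H by rewrite HE cycle_id.
have repA X0 : X0 \in cosets G H -> exists2 a, a \in A & X0 = H :* a.
  case/rcosetsP=> x Gx ->; have [ox|ox] := boolP (odd_perm (translation G J x)).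
    exists (t * x); last by rewrite rcosetM (rcoset_id Ht).
    by rewrite inE groupM // translationM // odd_permM odd_t ox.
  by exists x; rewrite // inE Gx.
have tiHA a b : a \in A -> b \in A -> H :* a = H :* b -> a = b.
  move=> Aa Ab /rcoset_eqP; rewrite mem_rcoset HE (cycle2g t2) => /set2P[].
    by move/(canRL (mulgKV _)); rewrite mul1g.
  move=> ab; have : a * b^-1 \in Group gA by rewrite groupM ?groupV.
  by rewrite ab inE Gt odd_t.
have fE a X0 : a \in A -> X0 \in cosets G H -> f a X0 = X0 :* a.
  by move=> /(subsetP sAG) Ga CX; apply: translationE.
exists (f @* Group gA)%G; split=> /=.
- by apply/subsetP=> _ /morphimP[a _ _ ->]; rewrite inE; apply: translation_on.
- move=> X0 Y0 CX CY; have [a Aa Xa] := repA _ CX; have [b Ab Yb] := repA _ CY.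
  have Aab : a^-1 * b \in Group gA by rewrite groupM ?groupV.
  exists (f (a^-1 * b)); split.
    split; first by rewrite mem_morphim ?(subsetP sAG).
    by rewrite fE // Xa Yb -rcosetM mulKVg.
  move=> _ [/morphimP[c Gc Ac ->] fc]; congr (f _).
  have Aac : a * c \in Group gA by rewrite groupM.
  rewrite -(tiHA (a * c) b) ?mulKg // -Yb -fc fE // Xa rcosetM //.
- by rewrite fG morphim_norms.
by rewrite fG morphimS.
Qed.

(** * Hopf Galois structures and regular subgroups *)

Close Scope group_scope.
Local Open Scope ring_scope.

(** * Group-like elements of M (x) H attached to embeddings *)

Section HopfCoordinates.
Variables (k : fieldType) (L M : fieldExtType k) (H : hopfAlgebra k).
Variable act : 'Hom(H, 'End(L)).
Hypothesis modA : module_algebra act.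
Hypothesis bijH : bijective (hopf_galois_map act).
Variable iota : {lrmorphism L -> M}.

Local Notation d := (\dim {:H}).
Local Notation e := (\dim {:L}).
Local Notation h := (vbasis {:H}).
Local Notation b := (vbasis {:L}).

(** The matrix over [L] of L (x) H -> End(L): coordinates v go to the map whose values on the basis
    of [L] are [v *m action_mx]. *)
Definition action_mx : 'M[L]_(d, e) := \matrix_(i, j) act h`_i b`_j.

Lemma hopf_galois_map_coord (t : tensor L H) s :
  hopf_galois_map act t s = \sum_j (\sum_i t i j *: b`_i) * act h`_j s.
Proof.
rewrite /hopf_galois_map /tlift sum_lfunE.
under eq_bigr => i _ do rewrite sum_lfunE.
rewrite exchange_big /=; apply: eq_bigr => j _.
rewrite mulr_suml; apply: eq_bigr => i _.
by rewrite scale_lfunE comp_lfunE lfunE /= scalerAl.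
Qed.

Lemma row_free_action_mx : row_free action_mx.
Proof.
apply: inj_row_free => v vQ0.
pose t : tensor L H := \matrix_(i, j) coord b i (v 0 j).
have tE j : \sum_i t i j *: b`_i = v 0 j.
  rewrite [RHS](coord_vbasis (memvf _)); apply: eq_bigr => i _.
  by rewrite mxE.
suff t0 : t = 0.
  by apply/rowP=> j; rewrite -tE t0 mxE big1 // => i _; rewrite mxE scale0r.
apply: (bij_inj bijH); apply/lfunP=> s; rewrite !hopf_galois_map_coord.
rewrite [RHS]big1 => [|j _]; last first.
  by rewrite big1 ?mul0r // => i _; rewrite mxE scale0r.
rewrite {1}(coord_vbasis (memvf s)).
under eq_bigr => j _.
  rewrite tE linear_sum mulr_sumr.
  under eq_bigr => i _ do rewrite linearZ /= -scalerAr.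
  over.
rewrite exchange_big big1 //= => i _; rewrite -scaler_sumr.
rewrite (_ : \sum_j _ = 0) ?scaler0 //.
have /rowP/(_ i) := vQ0; rewrite !mxE => vQi; rewrite -[RHS]vQi.
by apply: eq_bigr => j _; rewrite mxE.
Qed.

(** Preimages of the coordinate functions of [L] are the rows of a left inverse. *)
Lemma row_full_action_mx : row_full action_mx.
Proof.
have [g _ gK] := bijH.
have f_lin i : linear (fun s : L => coord b i s *: (1 : L)).
  by move=> a s t; rewrite linearP /= scalerDl scalerA.
pose fl i : {linear L -> L} := HB.pack (fun s : L => coord b i s *: (1 : L))
  (GRing.isLinear.Build _ _ _ _ _ (f_lin i)).
pose f i : 'End(L) := linfun (fl i).
pose B : 'M[L]_(e, d) := \matrix_(i, j) \sum_i' g (f i) i' j *: b`_i'.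
apply/row_fullP; exists B; apply/matrixP=> i j; rewrite !mxE.
transitivity (f i b`_j).
  rewrite -[in RHS](gK (f i)) hopf_galois_map_coord.
  by apply: eq_bigr => l _; rewrite !mxE.
rewrite lfunE /= coord_free ?(basis_free (vbasisP _)) //.
by rewrite eq_sym scaler_nat.
Qed.

(* twist m x is s |-> x (u s) for the element u = sum_j m_j (x) h_j of         *)
(* M (x) H; hopf_coord g below are the coordinates m of the u that sends iota  *)
(* to g.                                                                       *)
Definition twist (m : 'rV[M]_d) (x : L -> M) (s : L) : M :=
  \sum_j m 0 j * x (act h`_j s).

(** Freeness of the rows survives extension of scalars along any embedding, so [iota] can later be
    replaced by another one. *)
Lemma twist_inj m m' : twist m iota =1 twist m' iota -> m = m'.
Proof.
move=> emm'; apply/eqP; rewrite -subr_eq0; apply/eqP.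
have freeQ : row_free (map_mx iota action_mx).
  by rewrite row_free_map row_free_action_mx.
apply: (row_free_inj freeQ); rewrite mul0mx mulmxBl; apply/eqP.
rewrite subr_eq0.
apply/eqP/rowP=> i; have := emm' b`_i; rewrite !mxE /twist => emi.
rewrite (eq_bigr (fun j => m 0 j * iota (act h`_j b`_i))) => [|j _]; last first.
  by rewrite !mxE.
by rewrite emi; apply: eq_bigr => j _; rewrite !mxE.
Qed.

Definition hopf_coord (g : L -> M) : 'rV[M]_d :=
  (\row_j g b`_j) *m pinvmx (map_mx iota action_mx).

Lemma twist_linear m (x : {linear L -> M}) : linear (twist m x).
Proof.
move=> a s t; rewrite /twist scaler_sumr -big_split /=; apply: eq_bigr => j _.
by rewrite !linearP mulrDr scalerAr.
Qed.

Lemma hopf_coordK (g : {linear L -> M}) : twist (hopf_coord g) iota =1 g.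
Proof.
move=> s; pose m := hopf_coord g.
have mQ : m *m map_mx iota action_mx = \row_j g b`_j.
  by rewrite mulmxKpV // submx_full // row_full_map row_full_action_mx.
pose f : {linear L -> M} := HB.pack (twist m iota)
  (GRing.isLinear.Build _ _ _ _ _ (twist_linear m iota)).
change (f s = g s); rewrite (coord_vbasis (memvf s)) !linear_sum.
apply: eq_bigr => i _; rewrite !linearZ; congr (_ *: _).
have /rowP/(_ i) := mQ; rewrite !mxE => <-; apply: eq_bigr => j _.
by rewrite !mxE.
Qed.

Lemma tlift_comul_act (x : {lrmorphism L -> M}) l s t :
  x (act h`_l (s * t)) =
  \sum_(i < d) \sum_(j < d)
    comul H h`_l i j *: (x (act h`_i s) * x (act h`_j t)).
Proof.
have [_ _ _ ->] := modA; rewrite /tlift linear_sum; apply: eq_bigr => i _.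
rewrite linear_sum; apply: eq_bigr => j _.
by rewrite linearZ /= rmorphM.
Qed.

(** This says that the comultiplication sends u to u (x) u. Expand g (s t) = g s * g t and cancel s,
    then t, by [twist_inj]. *)
Lemma hopf_coord_grouplike (g : {lrmorphism L -> M}) (i j : 'I_d)
    (m := hopf_coord g) :
  \sum_(l < d) comul H h`_l i j *: m 0 l = m 0 i * m 0 j.
Proof.
have gE s : g s = \sum_(l < d) m 0 l * iota (act h`_l s).
  by rewrite -[LHS](hopf_coordK g).
clearbody m.
pose D (i j : 'I_d) := \sum_(l < d) comul H h`_l i j *: m 0 l.
suff Deq t : (\row_i \sum_j D i j * iota (act h`_j t)) = (\row_i (m 0 i * g t)).
  have /rowP/(_ j) : \row_j D i j = \row_j (m 0 i * m 0 j).
    apply: twist_inj => t; have /rowP/(_ i) := Deq t.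
    rewrite !mxE gE mulr_sumr => Dt.
    rewrite /twist; under eq_bigr => l _ do rewrite mxE.
    by rewrite Dt; apply: eq_bigr => l _; rewrite mxE mulrA.
  by rewrite !mxE.
apply: twist_inj => s; transitivity (g (s * t)).
  rewrite gE /twist.
  under [RHS]eq_bigr => l _ do rewrite tlift_comul_act mulr_sumr.
  rewrite exchange_big /=; apply: eq_bigr => p _.
  rewrite mxE mulr_suml; under [RHS]eq_bigr => l _ do rewrite mulr_sumr.
  rewrite exchange_big /=; apply: eq_bigr => q _.
  rewrite /D !mulr_suml; apply: eq_bigr => l _.
  by rewrite -!scalerAl -scalerAr mulrAC -!mulrA.
rewrite rmorphM /= (gE s) mulr_suml /twist; apply: eq_bigr => l _.
by rewrite mxE mulrAC.
Qed.

(** The counit of u is 1, read off from g 1 = 1. *)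
Lemma hopf_coord_counit (g : {lrmorphism L -> M}) :
  \sum_(l < d) counit H h`_l *: hopf_coord g 0 l = 1.
Proof.
have := hopf_coordK g 1; rewrite rmorph1 => <-; apply: eq_bigr => l _.
have [_ _ -> _] := modA.
by rewrite linearZ /= rmorph1 -scalerAr mulr1.
Qed.

Section Twist.
Variables g x : {lrmorphism L -> M}.
Local Notation m := (hopf_coord g).

Lemma twistM s t : twist m x (s * t) = twist m x s * twist m x t.
Proof.
rewrite /twist; under eq_bigr => l _ do rewrite tlift_comul_act mulr_sumr.
rewrite exchange_big mulr_suml /=; apply: eq_bigr => i _.
rewrite mulr_sumr; under eq_bigr => l _ do rewrite mulr_sumr.
rewrite exchange_big /=; apply: eq_bigr => j _.
rewrite mulrACA -hopf_coord_grouplike mulr_suml.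
by apply: eq_bigr => l _; rewrite -scalerAr scalerAl.
Qed.

Lemma twist1 : twist m x 1 = 1.
Proof.
rewrite -[RHS](hopf_coord_counit g); apply: eq_bigr => l _.
have [_ _ -> _] := modA.
by rewrite linearZ /= rmorph1 -scalerAr mulr1.
Qed.

(** For group-like u, the product of u and its antipode is the counit of u, that is 1; so u acts
    injectively on embeddings. *)
Lemma twist_antipode s :
  \sum_(j < d) m 0 j * twist m x (act (antipode H h`_j) s) = x s.
Proof.
have actm (a c : H) : act a (act c s) = act (a * c) s by have [_ ->] := modA.
transitivity (\sum_(l < d) m 0 l * x (act (counit H h`_l)%:A s)); last first.
  rewrite -[RHS]mul1r -(hopf_coord_counit g) mulr_suml; apply: eq_bigr => l _.
  have act1 : act 1 s = s by have [->] := modA.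
  by rewrite linearZ /= scale_lfunE act1 linearZ /= -scalerAr scalerAl.
under [RHS]eq_bigr => l _.
  rewrite -antipoder /tlift linear_sum sum_lfunE linear_sum mulr_sumr.
  under eq_bigr => i _.
    rewrite linear_sum sum_lfunE linear_sum mulr_sumr.
    under eq_bigr => j _.
      rewrite linearZ /= scale_lfunE linearZ /= -actm -scalerAr scalerAl.
      over.
    over.
  over.
rewrite [RHS]exchange_big /=.
under [RHS]eq_bigr => i _ do rewrite exchange_big /=.
rewrite [RHS]exchange_big /=; apply: eq_bigr => j _.
rewrite /twist mulr_sumr; apply: eq_bigr => i _.
by rewrite -mulr_suml hopf_coord_grouplike mulrA [X in X * _]mulrC.
Qed.

End Twist.

Lemma twist_cancel (g x y : {lrmorphism L -> M}) :
  twist (hopf_coord g) x =1 twist (hopf_coord g) y -> x =1 y.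
Proof.
move=> exy s; rewrite -(twist_antipode g x) -(twist_antipode g y).
by apply: eq_bigr => j _; rewrite exy.
Qed.

(** The product of M (x) H in coordinates, for which [twist] is a right action. *)
Definition hopf_coord_mul (m m' : 'rV[M]_d) : 'rV[M]_d :=
  \row_l \sum_(i < d) \sum_(j < d) coord h l (h`_i * h`_j) *: (m 0 i * m' 0 j).

Lemma twist_mul m m' (x : {lrmorphism L -> M}) :
  twist m' (twist m x) =1 twist (hopf_coord_mul m m') x.
Proof.
move=> s.
have actm (a c : H) : act a (act c s) = act (a * c) s by have [_ ->] := modA.
transitivity (\sum_(j < d) \sum_(i < d)
                m' 0 j * (m 0 i * x (act (h`_i * h`_j) s))).
  apply: eq_bigr => j _; rewrite mulr_sumr; apply: eq_bigr => i _.
  by rewrite actm.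
rewrite exchange_big /=; under [RHS]eq_bigr => l _.
  rewrite mxE mulr_suml; under eq_bigr => i _ do rewrite mulr_suml.
  over.
rewrite [RHS]exchange_big /=; apply: eq_bigr => i _.
rewrite [RHS]exchange_big /=; apply: eq_bigr => j _.
rewrite {1}(coord_vbasis (memvf (h`_i * h`_j))) linear_sum sum_lfunE.
rewrite linear_sum !mulr_sumr.
apply: eq_bigr => l _; rewrite linearZ /= scale_lfunE linearZ /=.
by rewrite -!scalerAr -scalerAl mulrCA mulrA.
Qed.

Lemma hopf_coord_comp (g g' z : {lrmorphism L -> M}) :
  twist (hopf_coord g') g =1 z ->
  hopf_coord_mul (hopf_coord g) (hopf_coord g') = hopf_coord z.
Proof.
move=> ez; apply: twist_inj => s; rewrite -twist_mul hopf_coordK -[RHS]ez.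
by apply: eq_bigr => j _; rewrite hopf_coordK.
Qed.

Lemma twist_iota (x : {lrmorphism L -> M}) : twist (hopf_coord iota) x =1 x.
Proof.
have twist_id (y : {lrmorphism L -> M}) :
    twist (\row_j (coord h j 1)%:A) y =1 y.
  move=> s; have act1 : act 1 s = s by have [->] := modA.
  rewrite -[in RHS]act1 [in RHS](coord_vbasis (memvf (1 : H))).
  rewrite linear_sum sum_lfunE linear_sum.
  apply: eq_bigr => j _; rewrite mxE linearZ /= scale_lfunE linearZ /=.
  by rewrite -scalerAl mul1r.
suff -> : hopf_coord iota = \row_j (coord h j 1)%:A by apply: twist_id.
by apply: twist_inj => s; rewrite hopf_coordK twist_id.
Qed.

(** Galois elements also act on the coefficients in [M]; this is why the regular group is
    normalized. *)
Lemma twist_map (tau : {lrmorphism M -> M}) m (x : L -> M) s :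
  tau (twist m x s) = twist (map_mx tau m) (tau \o x) s.
Proof.
by rewrite /twist rmorph_sum; apply: eq_bigr => j _; rewrite rmorphM mxE.
Qed.

End HopfCoordinates.

(** * Embeddings of [F] in [M] as cosets *)

Section Embeddings.
Variables (k : fieldType) (M : splittingFieldType k) (F : {subfield M}).
Local Notation G := 'Gal({:M} / 1)%G.
Local Notation Gamma := 'Gal({:M} / F)%G.
Local Notation cosetsF := (cosets G Gamma).

Definition gal_res (x : gal_of {:M}) : {lrmorphism subvs_of F -> M} :=
  x \o vsval.

Lemma mem_gal1 (x : gal_of {:M}) : x \in G.
Proof.
rewrite gal_kHom ?subvf //; apply/kHomP_tmp.
split=> [a|a b _ _]; last exact: rmorphM.
by case/vlineP=> c ->; rewrite linearZ /= rmorph1.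
Qed.

Lemma mem_galF (x : gal_of {:M}) : reflect (gal_res x =1 vsval) (x \in Gamma).
Proof.
rewrite gal_kHom ?subvf //; apply: (iffP kHomP_tmp) => [[fixF _] s|fixF].
  exact: fixF (subvsP s).
split=> [a Fa|a b _ _]; last exact: rmorphM.
by have := fixF (Subvs Fa).
Qed.

Lemma gal_res_rcoset x y :
  gal_res x =1 gal_res y <-> (Gamma :* x = Gamma :* y)%g.
Proof.
split=> [exy|/eqP].
  apply/rcoset_eqP; rewrite mem_rcoset; apply/mem_galF=> s /=.
  rewrite galM ?memvf //; have /= -> := exy s.
  by rewrite -galM ?memvf // mulgV gal_id.
move/eqP=> exy; have : (x \in Gamma :* y)%g by rewrite -exy rcoset_refl.
case/rcosetP=> z /mem_galF fixz -> s /=.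
by rewrite galM ?memvf //; have /= -> := fixz s.
Qed.

(** Embeddings of [F] extend to automorphisms because M/k is normal. *)
Lemma gal_res_exists (f : {linear subvs_of F -> M}) :
  f 1 = 1 -> (forall s t, f (s * t) = f s * f t) -> exists x, gal_res x =1 f.
Proof.
move=> f1 fM; pose phi : 'End(M) := linfun (f \o vsproj F).
have phiE a : phi a = f (vsproj F a) by rewrite lfunE.
have homphi : kHom 1 F phi.
  apply/kHomP_tmp; split=> [a|a b Fa Fb].
    case/vlineP=> c ->; rewrite linearZ /= phiE.
    rewrite -(rmorph1 (vsval : {rmorphism subvs_of F -> M})) vsvalK.
    by rewrite f1 rmorph1.
  rewrite !phiE -fM; congr (f _); apply: val_inj.
  by rewrite /= !vsprojK // rpredM.
have [|x _ ex] := kHom_to_gal _ (normalFieldf 1) homphi.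
  by rewrite sub1v subvf.
by exists x => s /=; rewrite -ex ?subvsP // phiE vsvalK.
Qed.

Definition coset_res (X : {set gal_of {:M}}) := gal_res (repr X).

Lemma coset_reprK X : X \in cosetsF -> (Gamma :* repr X)%g = X.
Proof.
by case/rcosetsP=> x _ ->; rewrite rcoset_repr.
Qed.

Lemma coset_res_rcoset x : coset_res (Gamma :* x)%g =1 gal_res x.
Proof. by apply/gal_res_rcoset; rewrite rcoset_repr. Qed.

Lemma mem_cosetsF x : (Gamma :* x)%g \in cosetsF.
Proof. by apply/rcosetsP; exists x; rewrite ?mem_gal1. Qed.

Lemma coset_res_inj X Y : X \in cosetsF -> Y \in cosetsF ->
  coset_res X =1 coset_res Y -> X = Y.
Proof.
by move=> CX CY /gal_res_rcoset; rewrite !coset_reprK.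
Qed.

Lemma coset_res_translation g X : X \in cosetsF ->
  coset_res (translation G Gamma g X) =1 g \o coset_res X.
Proof.
move=> CX s; rewrite translationE ?mem_gal1 // -{1}(coset_reprK CX) -rcosetM.
by rewrite coset_res_rcoset /= galM ?memvf.
Qed.

End Embeddings.

(** * The regular group of a Hopf Galois structure *)

Section GreitherPareigis.
Variables (k : fieldType) (M : splittingFieldType k) (F : {subfield M}).
Local Notation G := 'Gal({:M} / 1)%G.
Local Notation Gamma := 'Gal({:M} / F)%G.
Local Notation cosetsF := (cosets G Gamma).
Local Notation L := (subvs_of F).
Local Notation iota := (vsval : {lrmorphism L -> M}).
Variables (H : hopfAlgebra k) (act : 'Hom(H, 'End(L))).
Hypothesis modA : module_algebra act.
Hypothesis bijH : bijective (hopf_galois_map act).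

Local Notation twist := (twist act).
Local Notation coord C := (hopf_coord act iota (coset_res F C)).

Lemma twist_ext m (x y : L -> M) : x =1 y -> twist m x =1 twist m y.
Proof. by move=> exy s; apply: eq_bigr => j _; rewrite exy. Qed.

Lemma twist_coset_exists C X : exists2 Y, Y \in cosetsF &
  coset_res F Y =1 twist (coord C) (coset_res F X).
Proof.
set m := coord C; set x := coset_res F X.
pose f : {linear L -> M} :=
  HB.pack (twist m x) (GRing.isLinear.Build _ _ _ _ _ (twist_linear act m x)).
have [||z ez] := @gal_res_exists _ _ _ f.
- exact: twist1 modA bijH iota _ x.
- exact: twistM modA bijH iota _ x.
exists (Gamma :* z)%g; first exact: mem_cosetsF.
by move=> s; rewrite coset_res_rcoset ez.
Qed.

Lemma twist_perm_exists C : exists p : {perm {set gal_of {:M}}},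
  p \in perm.Sym cosetsF /\
  {in cosetsF, forall X, coset_res F (p X) =1 twist (coord C) (coset_res F X)}.
Proof.
(* Off the cosets the map is the identity, so that the permutation lies in [perm.Sym cosetsF]. *)
have /fin_all_exists[f fP] (X : {set gal_of {:M}}) :
  exists Y : {set gal_of {:M}},
    if X \in cosetsF then Y \in cosetsF /\
      coset_res F Y =1 twist (coord C) (coset_res F X) else Y = X.
  case: (X \in cosetsF); last by exists X.
  by have [Y] := twist_coset_exists C X; exists Y.
have fC X : (f X \in cosetsF) = (X \in cosetsF).
  by have := fP X; case: ifP => [_ []|CX ->].
have inj_f : injective f.
  move=> X Y eXY; have := fC X; rewrite eXY fC => CXY.
  have := fP X; have := fP Y; rewrite eXY CXY.
  case: ifP => CY; last by move->.
  move=> [_ eY] [_ eX]; apply: (coset_res_inj (F := F)); rewrite ?CXY //.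
  apply: (twist_cancel modA bijH (iota := iota) (g := coset_res F C)) => s.
  by rewrite -eX -eY.
exists (perm inj_f); split.
  rewrite inE; apply/subsetP=> X; rewrite unfold_in /= permE.
  apply: contraR => nCX.
  by have := fP X; rewrite (negPf nCX) => ->.
by move=> X CX s; have := fP X; rewrite CX permE => -[_ ->].
Qed.

Lemma Sym_coset_res_inj (p q : {perm {set gal_of {:M}}}) :
  p \in perm.Sym cosetsF -> q \in perm.Sym cosetsF ->
  {in cosetsF, forall X, coset_res F (p X) =1 coset_res F (q X)} -> p = q.
Proof.
move=> Sp Sq epq; apply/permP=> X.
have [CX|nCX] := boolP (X \in cosetsF); last first.
  move: Sp Sq; rewrite !inE => Sp Sq.
  by rewrite (out_perm Sp nCX) (out_perm Sq nCX).
by apply: (coset_res_inj (F := F)); rewrite ?Sym_closed //; apply: epq.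
Qed.

Lemma coord_eq C m : twist m iota =1 coset_res F C -> m = coord C.
Proof.
by move=> em; apply: (twist_inj bijH (iota := iota)) => s; rewrite hopf_coordK.
Qed.

(** Each coset [C] has a group-like u sending the inclusion to the embedding of [C], and [p C] is
    its action on embeddings. Existence and uniqueness of u make these permutations a regular
    group. *)
Theorem Hopf_Galois_regular_normalized :
  exists N : {group {perm {set gal_of {:M}}}},
    [/\ N \subset perm.Sym cosetsF, sharply_transitive cosetsF N &
        translation G Gamma @: G \subset 'N(N)]%g.
Proof.
have [p pP] := fin_all_exists twist_perm_exists.
have pS C : p C \in perm.Sym cosetsF by have [] := pP C.
have pE C X s : X \in cosetsF ->
    coset_res F (p C X) s = twist (coord C) (coset_res F X) s.
  by move=> CX; have [_ ->] := pP C.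
have pC C X : (p C X \in cosetsF) = (X \in cosetsF).
  exact: Sym_closed.
pose N := (p @: cosetsF).
have C1 : (Gamma : {set _}) \in cosetsF by rewrite -(rcoset1 Gamma) mem_cosetsF.
have r1 : coset_res F Gamma =1 vsval by apply/mem_galF; apply: (mem_repr 1%g).
have gN : group_set N.
  apply/group_setP; split=> [|_ _ /imsetP[C CC ->] /imsetP[D CD ->]].
    apply/imsetP; exists (Gamma : {set _}) => //.
    apply: Sym_coset_res_inj => [||X CX s] //.
    rewrite pE // perm1 -(twist_iota modA bijH iota).
    congr (twist _ _ s); apply: coord_eq => {}s.
    by rewrite r1 (twist_iota modA bijH).
  (* [p C] sends the base coset to [C] and [p D] sends [C] to [p D C], which therefore indexes the
     product. *)
  apply/imsetP; exists (p D C); first by rewrite pC.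
  apply: Sym_coset_res_inj => [||X CX s] //; first by rewrite groupM.
  rewrite permM !pE ?pC // -(hopf_coord_comp modA bijH
    (g := coset_res F C) (g' := coset_res F D) (z := coset_res F (p D C))).
    rewrite -(twist_mul modA). apply: twist_ext => {}s; exact: pE.
  by move=> {}s; rewrite pE.
exists (Group gN); split.
- by apply/subsetP=> _ /imsetP[C _ ->]; apply: pS.
- move=> X Y CX CY.
  (* Taking [twist_inj] at the embedding of [X] shows that [p C X] determines [C]; finiteness then
     gives transitivity. *)
  have injX : {in cosetsF &, injective (fun C => p C X)}.
    move=> C D CC CD /= eCD; apply: (coset_res_inj (F := F)) => // s.
    have -> : coset_res F C s = twist (coord C) iota s by rewrite hopf_coordK.
    rewrite (_ : coord C = coord D) ?hopf_coordK //.
    apply: (twist_inj bijH (iota := coset_res F X)) => {}s.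
    by rewrite -!pE // eCD.
  have /(_ Y) : (fun C => p C X) @: cosetsF =i cosetsF.
    apply/subset_cardP; first exact: card_in_imset.
    by apply/subsetP=> _ /imsetP[C _ ->]; rewrite pC.
  rewrite CY => /imsetP[C CC eY]; exists (p C); split.
    by split; [apply: imset_f | rewrite eY].
  by move=> _ [/imsetP[D CD ->] eD]; congr p; apply: injX; rewrite // -eY.
apply/subsetP=> _ /imsetP[g _ ->]; rewrite inE.
apply/subsetP=> _ /imsetP[_ /imsetP[C CC ->] ->].
set t := translation G Gamma g.
have tS : t \in perm.Sym cosetsF by rewrite inE translation_on.
have tC X : (t X \in cosetsF) = (X \in cosetsF).
  exact: Sym_closed.
have tE X s : X \in cosetsF -> coset_res F (t X) s = g (coset_res F X s).
  by move=> CX; rewrite coset_res_translation.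
have conjE X s : X \in cosetsF -> coset_res F ((p C ^ t)%g (t X)) s =
    twist (map_mx g (coord C)) (coset_res F (t X)) s.
  move=> CX; rewrite permJ tE ?pC // pE // twist_map.
  by apply: twist_ext => {}s; rewrite tE.
(* The conjugate acts through the coordinates of [C] moved by g, so its value at the base coset
   indexes it. *)
apply/imsetP; exists ((p C ^ t)%g Gamma).
  by rewrite Sym_closed ?groupJ.
apply: Sym_coset_res_inj => [||X CX s] //; first by rewrite groupJ.
rewrite -[X](permKV t) conjE ?pE ?permKV //; last by rewrite -tC permKV.
congr (twist _ _ s); apply: coord_eq => {}s.
rewrite -[(Gamma : {set _})](permKV t) conjE; last by rewrite -tC permKV.
by apply: twist_ext => {}s; rewrite permKV r1.
Qed.

End GreitherPareigis.

Close Scope ring_scope.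

Theorem proposition4p13 (k : fieldType) (Kt : splittingFieldType k)
    (K F : {subfield Kt})
    (sepK : separable 1 K) (degK : \dim K = 6%N) (closK : Galois_closure K)
    (galS6 : ('Gal({:Kt} / 1) \isog [set: 'S_6])%g)
    (sKF : (K <= F)%VS) :
  (\dim F = 360%N ->
   (exists2 t, translation_transposition 'Gal({:Kt} / 1)%G 'Gal({:Kt} / K)%G t
             & ('Gal({:Kt} / F) = <[t]>)%g) ->
   almost_classically_Galois (subvs_of F)) /\
  ((\dim F < 360)%N -> ~ Hopf_Galois (subvs_of F)).
Proof.
have [gal1 minK] := closK.
split=> [dimF [t tt HE]|ltF [H [act [_ modA bijH]]]]; last first.
  have [A [nsA iA simA oA]] := isog_S6_simple_subgroup galS6.
  have [N [sNS stN nNG]] := Hopf_Galois_regular_normalized modA bijH.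
  apply: no_regular_normalized nsA iA simA oA _ _ _ sNS nNG stN.
  - by rewrite galS ?sub1v.
  - by rewrite card_gal_cosets // (dvdn_trans _ (field_dimS sKF)) // degK.
  - by rewrite card_gal_cosets.
exists Kt, (linfun_ahom (vsval : {lrmorphism subvs_of F -> Kt})).
set iota := linfun_ahom _.
have eF : (iota @: {:subvs_of F})%VS = F.
  apply/vspaceP=> a; apply/memv_imgP/idP=> [[s _ ->]|Fa].
    by rewrite lfunE subvsP.
  by exists (Subvs Fa); rewrite ?memvf // lfunE.
have eF' : (iota @: {:subvs_of F})%AS = F by apply: val_inj.
rewrite eF' eF; split.
  (* A Galois subextension containing [F] contains [K], so [Kt] is also the closure of [F]. *)
  by split=> // E' /(subv_trans sKF); apply: minK.
apply: (regular_normalized_of_transposition _ _ HE tt).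
  by rewrite (subsetP (galS _ (sub1v F))) // HE cycle_id.
(* [t] has order 2 because 720 = 360 * #[t]. *)
have := card_gal_cosets F gal1; rewrite dimF => iF.
have := Lagrange (galS {:Kt} (sub1v F)).
rewrite iF /= HE (card_isog galS6) cardsT card_Sn.
by move/eqP; rewrite -[6`!]/(2 * 360)%N eqn_pmul2r // => /eqP.
Qed.
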